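(* Let $\alpha\geq 5$ be an integer and let $\mathcal{G}_{\alpha}$ be any hereditary class of graphs (every subgraph of a graph in $\mathcal{G}_{\alpha}$ belongs to $\mathcal{G}_{\alpha}$) such that every graph $G\in\mathcal{G}_{\alpha}$ has minimum degree at most $1$, or contains an edge $uv$ with $d_G(u)+d_G(v)\leq \alpha$, or contains a 2-alternating cycle. Then every graph $G\in\mathcal{G}_{\alpha}$ with maximum degree $\Delta$ can be edge-partitioned into two forests $F_1$, $F_2$ and a subgraph $H$ (i.e. $E(G)$ is the disjoint union of $E(F_1)$, $E(F_2)$, $E(H)$) such that $\Delta(F_i)\leq \max\{2,\lceil\frac{\Delta-\alpha+6}{2}\rceil\}$ for $i=1,2$ and $\Delta(H)\leq \alpha-5$.
   Context: Graphs are finite and simple. $d_G(v)$ denotes the degree of $v$ in $G$, and $\Delta(\cdot)$ denotes maximum degree. A 2-alternating cycle in $G$ is a cycle $v_0v_1\cdots v_{2n-1}v_0$ (with $n\geq 2$) such that $d_G(v_0)=d_G(v_2)=\cdots=d_G(v_{2n-2})=2$. *)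

(* Defs.v *)
From mathcomp Require Import all_boot.

Set Implicit Arguments.
Unset Strict Implicit.
Unset Printing Implicit Defensive.

(* The vertex set of a graph may be empty. *)
Record sgraph := SGraph {
  vertex :> finType;
  adj : rel vertex;
  adj_sym : symmetric adj;
  adj_irrefl : irreflexive adj }.

Section Graph.
Variable G : sgraph.

Definition edges : {set {set G}} :=
  [set [set p.1; p.2] | p in [set p : G * G | adj p.1 p.2]].

Definition degree (x : G) : nat := #|[set y | adj x y]|.

Definition max_degree : nat := \max_(x : G) degree x.

(* The default value [max_degree] is harmless when [G] has a vertex, and is 0
   when it has none: the null graph, which is a subgraph of every graph, has
   minimum degree 0. *)
Definition min_degree : nat := \big[minn/max_degree]_(x : G) degree x.

Definition is_cycle (c : seq G) : Prop :=
  2 < size c /\ ucycle (@adj G) c.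

Definition is_forest : Prop := forall c : seq G, ~ is_cycle c.

Definition is_2alternating_cycle (c : seq G) : Prop :=
  is_cycle c /\
  exists2 n : nat, 2 <= n &
    size c = n.*2 /\ forall (x0 : G) (i : nat), i < n -> degree (nth x0 c i.*2) = 2.

(* Not necessarily induced, not necessarily spanning. *)
Record subgraph := Subgraph {
  sub_vertices : {set G};
  sub_edges : {set {set G}};
  sub_edges_edges : sub_edges \subset edges;
  sub_edges_vertices :
    forall e : {set G}, e \in sub_edges -> e \subset sub_vertices }.

End Graph.

Lemma set2_edges (G : sgraph) (x y : G) : ([set x; y] \in edges G) = adj x y.
Proof.
apply/imsetP/idP => [[[a b]] | xy]; last by exists (x, y); rewrite ?inE.
rewrite inE /= => ab e.
have nab : a != b by apply/eqP => eab; rewrite eab adj_irrefl in ab.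
have : a \in [set x; y] by rewrite e !inE eqxx.
have : b \in [set x; y] by rewrite e !inE eqxx orbT.
rewrite !inE => /orP[] /eqP eb /orP[] /eqP ea; subst a b => //.
- by rewrite eqxx in nab.
- by rewrite adj_sym.
- by rewrite eqxx in nab.
Qed.

Section SubgraphGraph.
Variables (G : sgraph) (S : subgraph G).

Definition sub_adj : rel {x : G | x \in sub_vertices S} :=
  fun x y => [set val x; val y] \in sub_edges S.

Lemma sub_adj_sym : symmetric sub_adj.
Proof. by move=> x y; rewrite /sub_adj setUC. Qed.

Lemma sub_adj_irrefl : irreflexive sub_adj.
Proof.
move=> x; apply/negP => /(subsetP (sub_edges_edges S)).
by rewrite set2_edges adj_irrefl.
Qed.

Definition graph_of_subgraph : sgraph := SGraph sub_adj_sym sub_adj_irrefl.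

End SubgraphGraph.

Coercion graph_of_subgraph : subgraph >-> sgraph.

(* Invariance of [C] under isomorphism is not required. *)
Definition hereditary (C : sgraph -> Prop) : Prop :=
  forall G : sgraph, C G -> forall S : subgraph G, C S.

Definition edge_partition (G : sgraph) (A B D : subgraph G) : Prop :=
  [/\ edges G = sub_edges A :|: sub_edges B :|: sub_edges D,
      [disjoint sub_edges A & sub_edges B],
      [disjoint sub_edges A & sub_edges D] &
      [disjoint sub_edges B & sub_edges D]].

(* Main.v *)
Require Import Defs.
From mathcomp Require Import all_boot zify.

Set Implicit Arguments.
Unset Strict Implicit.
Unset Printing Implicit Defensive.

(* Put h = alpha - 5 and k(d) = max(2, ceil((d + 1 - h) / 2)). By induction on
   the number of edges one finds a partition in which every vertex v has degree
   at most k(d(v)) in both forests and at most h in H. Note that 2 k(d) + h > d.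
   If some vertex is a leaf, or some edge uv has d(u) + d(v) <= alpha, remove
   the edge and put it back greedily. For a 2-alternating cycle remove all its
   edges. As the bound k decreased with the degree, an odd vertex has either
   room for one more edge in each forest, or k = 2 and room for an edge in H.
   The two edges at an odd vertex are coloured so that no vertex of degree 2
   receives two edges of the same forest; hence the new forest edges are
   pendant. *)

(** For degrees after recoloring a cycle: [N] is the old neighborhood in one color, and [x], [y] are
    the two cycle neighbors, each counted only when its edge has that color. *)
Lemma card_setU_two (T : finType) (N S : {set T}) x y (p q : bool) :
  (forall z, z \in S -> [\/ z \in N, z = x /\ p | z = y /\ q]) ->
  #|S| <= #|N| + p + q.
Proof.
move=> HS; pose P := [set z | (z == x) && p]; pose Q := [set z | (z == y) && q].
have le1 (z : T) (b : bool) : #|[set t | (t == z) && b]| <= b.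
  case: b; first by rewrite (_ : [set _ | _] = [set z]) ?cards1 //;
    apply/setP => t; rewrite !inE andbT.
  by rewrite leqn0 cards_eq0; apply/eqP/setP => t; rewrite !inE andbF.
apply: (@leq_trans #|N :|: P :|: Q|).
  apply/subset_leq_card/subsetP => z /HS[zN|[-> pt]|[-> qt]];
  by rewrite !inE ?zN ?pt ?qt ?eqxx ?orbT.
apply: leq_trans (leq_card_setU _ _).1 _; apply: leq_add (le1 y q).
by apply: leq_trans (leq_card_setU _ _).1 _; rewrite leq_add2l; apply: le1.
Qed.

(** * Graphs as edge sets: connectivity, acyclicity and degrees *)

Section EdgeSets.
Variable T : finType.
Implicit Types (E F : {set {set T}}) (x y u v : T) (c : option bool).

(** The vertex type stays fixed, so deleting edges in the induction never changes types. *)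
Definition erel E : rel T := fun x y => [set x; y] \in E.
Definition nbr E x : {set T} := [set y | erel E x y].
Definition deg E x : nat := #|nbr E x|.

(* Every edge is a bridge: unlike the absence of cyclic sequences, this is easy
   to preserve when an edge is added. *)
Definition acyclic E : Prop :=
  forall x y, erel E x y -> ~~ connect (erel (E :\ [set x; y])) x y.

Lemma erel_sym E : symmetric (erel E).
Proof. by move=> x y; rewrite /erel setUC. Qed.

Lemma connect_erel_sym E : connect_sym (erel E).
Proof. exact/sym_connect_sym/erel_sym. Qed.

Lemma connect_erelS E F x y :
  E \subset F -> connect (erel E) x y -> connect (erel F) x y.
Proof.
move=> /subsetP EF; apply: connect_sub => a b ab; apply: connect1; exact: EF.
Qed.

Lemma degS E F x : E \subset F -> deg E x <= deg F x.
Proof.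
move=> /subsetP EF; apply: subset_leq_card; apply/subsetP => y.
by rewrite !inE; apply: EF.
Qed.

Lemma acyclicS E F : E \subset F -> acyclic F -> acyclic E.
Proof.
move=> EF aF x y xy; have := aF x y (subsetP EF _ xy).
by apply: contra; apply: connect_erelS; apply: setSD.
Qed.

Lemma set2_eq u v x y : [set u; v] = [set x; y] ->
  (u = x /\ v = y) \/ (u = y /\ v = x).
Proof.
move=> eS.
have: u \in [set x; y] by rewrite -eS set21.
have: v \in [set x; y] by rewrite -eS set22.
have: x \in [set u; v] by rewrite eS set21.
have: y \in [set u; v] by rewrite eS set22.
rewrite !inE.
by do 4![case/orP=> /eqP ?]; subst; auto.
Qed.

(** One crossing of the new edge suffices: at a further crossing, the case reached so far already
    connects [x] within [E] to an end of that edge. *)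
Lemma connect_setU1 E u v x y :
  connect (erel ([set u; v] |: E)) x y ->
  [|| connect (erel E) x y,
      connect (erel E) x u && connect (erel E) v y |
      connect (erel E) x v && connect (erel E) u y].
Proof.
case/connectP => p; elim/last_ind: p y => [|p z IHp] y; first by move=> _ ->; rewrite connect0.
rewrite rcons_path last_rcons => /andP[/IHp/(_ erefl) + lz] ->.
move: (last x p) lz => t; rewrite /erel in_setU1 => /orP[/eqP /set2_eq[] [-> ->]|tz].
- by case/or3P => [->|/andP[-> _]|/andP[-> _]]; rewrite ?connect0 ?orbT.
- by case/or3P => [->|/andP[-> _]|/andP[-> _]]; rewrite ?connect0 ?orbT.
have step a : connect (erel E) a t -> connect (erel E) a z.
  by move=> /connect_trans; apply; apply: connect1.
by case/or3P => [/step->|/andP[-> /step->]|/andP[-> /step->]]; rewrite ?orbT.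
Qed.

(** If an old edge [xy] were no longer a bridge, the detour from [x] to [y] would use [uv], and its
    two other pieces together with [xy] would join [u] to [v] in [E]. *)
Lemma acyclic_setU1 E u v :
  acyclic E -> ~~ connect (erel E) u v -> acyclic ([set u; v] |: E).
Proof.
move=> aE nuv x y.
have nuvE : [set u; v] \notin E by apply: contra nuv => uv; apply: connect1.
rewrite /erel in_setU1 => /orP[/eqP exy|xy].
  rewrite exy setU1K //; case: (set2_eq exy) => [] [-> ->] //.
  by rewrite connect_erel_sym.
have nxy : [set u; v] != [set x; y] by apply: contraNneq nuvE => ->.
have -> : ([set u; v] |: E) :\ [set x; y] = [set u; v] |: (E :\ [set x; y]).
  rewrite setDUl; congr (_ :|: _); apply/setDidPl.
  by rewrite disjoints1 inE.
apply/negP => /connect_setU1.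
have sub a b : connect (erel (E :\ [set x; y])) a b -> connect (erel E) a b.
  by apply: connect_erelS; apply: subsetDl.
have cxy : connect (erel E) x y by apply: connect1.
case/or3P => [|/andP[/sub xu /sub vy]|/andP[/sub xv /sub uy]].
- exact/negP/aE.
- case/negP: nuv; rewrite connect_erel_sym.
  apply: connect_trans vy _; rewrite connect_erel_sym in cxy.
  exact: connect_trans cxy xu.
- case/negP: nuv; apply: connect_trans uy _; rewrite connect_erel_sym in cxy.
  exact: connect_trans cxy xv.
Qed.

Lemma connect_deg E u v : u != v -> connect (erel E) u v -> 0 < deg E u.
Proof.
move=> nuv /connectP[[|y p] /= ]; first by move=> _ evu; rewrite evu eqxx in nuv.
by case/andP => uy _ _; rewrite card_gt0; apply/set0Pn; exists y; rewrite inE.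
Qed.

(** The edges are added one at a time. Each [e i] is still isolated when its turn comes, since
    earlier edges meet only other [e j] and vertices [g j]; so no path joins it to [g i]. *)
Lemma acyclic_pendants (I : finType) (e g : I -> T) E :
  injective e -> (forall i j, e i != g j) -> (forall i, deg E (e i) = 0) ->
  acyclic E -> acyclic (E :|: [set [set e i; g i] | i : I]).
Proof.
move=> inj_e eg dE aE.
suff H s : uniq s -> acyclic (E :|: [set [set e i; g i] | i in s]).
  apply: acyclicS (H _ (enum_uniq I)); apply: setUS; apply/subsetP => _ /imsetP[i _ ->].
  by apply: imset_f; rewrite mem_enum.
elim: s => [_|i s IHs /= /andP[ns us]].
  by apply: acyclicS aE; apply/subsetP => x; rewrite inE => /orP[//|/imsetP[]].
have sub : E :|: [set [set e j; g j] | j in i :: s]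
    \subset [set e i; g i] |: (E :|: [set [set e j; g j] | j in s]).
  apply/subsetP => x; rewrite !inE => /orP[->|/imsetP[j + ->]]; first by rewrite orbT.
  rewrite inE => /orP[/eqP->|js]; first by rewrite eqxx.
  by apply/orP; right; apply/orP; right; apply: imset_f.
apply: acyclicS sub _; apply: acyclic_setU1; first exact: IHs.
apply/negP => /(connect_deg (eg i i)); rewrite card_gt0 => /set0Pn[y].
rewrite inE /erel inE => /orP[iy|/imsetP[j js /set2_eq[] [eij _]]].
- by have := dE i; move/eqP; rewrite cards_eq0 => /eqP/setP/(_ y); rewrite !inE /erel iy.
- by move/inj_e: eij => eij; rewrite eij js in ns.
- by have := eg i j; rewrite eij eqxx.
Qed.

Lemma acyclic_ucycle E p : acyclic E -> 2 < size p -> ~ ucycle (erel E) p.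
Proof.
move=> aE; case: p => [|x [|y p]] //= sp /andP[/= /andP[xy yp] /andP[nx /andP[ny _]]].
(* The rest of the cycle leads from [y] back to [x] and avoids the edge [xy]. *)
have := aE x y xy; case/negP; rewrite connect_erel_sym.
apply/connectP; exists (rcons p x); last by rewrite last_rcons.
move: yp; rewrite !rcons_path => /andP[yp lx]; apply/andP; split.
  apply: (sub_in_path (P := [pred z | z != x])) yp.
    move=> a b; rewrite !inE => na nb ab; rewrite /erel !inE [_ \in E]ab andbT.
    apply/eqP => /set2_eq[] []; [move=> ea|move=> _ ea]; first by rewrite ea eqxx in na.
    by rewrite ea eqxx in nb.
  apply/allP => z zp; rewrite inE; apply: contraNneq nx => <-; exact: zp.
rewrite /erel !inE [_ \in E]lx andbT; apply/eqP => /set2_eq[] [].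
  by move=> elx; move: nx; rewrite -elx mem_last.
(* The closing edge could equal [xy] only in a cycle of length 2. *)
case: p sp ny {nx lx yp} => //= z p _ ny ely _; by move: ny; rewrite -ely mem_last.
Qed.

Lemma deg_setU1 E u v : [set u; v] \notin E -> deg ([set u; v] |: E) u = (deg E u).+1.
Proof.
move=> nE; rewrite /deg.
have -> : nbr ([set u; v] |: E) u = v |: nbr E u.
  apply/setP => y; rewrite !inE /erel in_setU1; congr (_ || _).
  by apply/eqP/eqP => [/set2_eq[] [] // -> ->|->].
by rewrite cardsU1 inE nE.
Qed.

Lemma deg_setU1_le E u v x :
  deg ([set u; v] |: E) x <= deg E x + ((x == u) || (x == v)).
Proof.
have [] := boolP ((x == u) || (x == v)) => H; last first.
  rewrite addn0; apply: subset_leq_card; apply/subsetP => y.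
  rewrite !inE /erel in_setU1 => /orP[/eqP/set2_eq[] [ex _]|//].
  - by rewrite ex eqxx in H.
  - by rewrite ex eqxx orbT in H.
have [uvE|uvE] := boolP ([set u; v] \in E).
  by rewrite (setUidPr _) ?sub1set // leq_addr.
by case/orP: H => /eqP->; last rewrite setUC in uvE *; rewrite addn1 deg_setU1.
Qed.

End EdgeSets.

(** * Colorings with degree bounds, and greedy extension by one edge *)

Section Colorings.
Variable T : finType.
Implicit Types (f : {set T} -> option bool) (E : {set {set T}}) (u v x y : T).
Implicit Types (c : option bool) (h d : nat).

(* [None] is the color of [H], and [Some b] are those of the two forests. *)
Definition color_class f E c : {set {set T}} := [set s in E | f s == c].

(** For [h = alpha - 5] and [d = max_degree G] the forest value is the bound of the theorem. *)
Definition capacity h d c : nat :=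
  if c is Some _ then maxn 2 (uphalf (d.+1 - h)) else h.

(* The bound at a vertex depends on its own degree and not on the maximum
   degree: this is what makes the induction go through for alternating cycles. *)
Definition good_coloring h E f : Prop :=
  (forall b, acyclic (color_class f E (Some b))) /\
  (forall c x, deg (color_class f E c) x <= capacity h (deg E x) c).

Lemma erel_class f E c x y :
  erel (color_class f E c) x y = erel E x y && (f [set x; y] == c).
Proof. by rewrite /erel inE. Qed.

Lemma deg_classes f E x :
  deg (color_class f E (Some true)) x + deg (color_class f E (Some false)) x +
  deg (color_class f E None) x = deg E x.
Proof.
rewrite /deg -(cardsID [set y | f [set x; y] == None] (nbr E x)) addnC.
rewrite -(cardsID [set y | f [set x; y] == Some true] (nbr E x :\: _)).
congr (_ + (_ + _)); apply: eq_card => y; rewrite !inE erel_class;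
  by case: (erel E x y) => //; case: (f _) => [[]|].
Qed.

Lemma capacityS h d d' c : d <= d' -> capacity h d c <= capacity h d' c.
Proof. by case: c => [b|] //= ; lia. Qed.

Lemma good_coloring_setU1 h E f u v c :
    u != v -> [set u; v] \notin E -> good_coloring h E f ->
    (forall b, c = Some b -> ~~ connect (erel (color_class f E c)) u v) ->
    (forall x, x \in [set u; v] ->
       deg (color_class f E c) x < capacity h (deg ([set u; v] |: E) x) c) ->
  exists f', good_coloring h ([set u; v] |: E) f'.
Proof.
move=> nuv nE [af df] nconn small.
exists (fun s => if s == [set u; v] then c else f s); set f' := fun s => _.
have class' c' : color_class f' ([set u; v] |: E) c' =
    if c' == c then [set u; v] |: color_class f E c' else color_class f E c'.
  apply/setP => s; rewrite inE in_setU1 /f' [c' == c]eq_sym.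
  have [->|ns] := eqVneq s [set u; v].
    by case: ifP => _; rewrite !inE ?eqxx // (negbTE nE).
  by case: ifP => _; rewrite !inE // (negbTE ns).
split=> [b|c' x]; rewrite class'; case: eqP => [ecc|_] //.
- by rewrite ecc; apply: acyclic_setU1; [rewrite -ecc|apply: (nconn b)].
- rewrite ecc; apply: leq_trans (deg_setU1_le _ _ _ _) _.
  have := small x; rewrite !inE; case: orP => [_ /(_ isT)|_ _].
    by rewrite addn1.
  by rewrite addn0; apply: leq_trans (df _ _) _; apply/capacityS/degS/subsetUr.
- by apply: leq_trans (df _ _) _; apply/capacityS/degS/subsetUr.
Qed.

(** Some color has room at [u]: three full classes would give [u] at least [2 k + h] edges, more
    than its new degree. Since [v] is isolated, no cycle arises. *)
Lemma good_coloring_pendant h E u v :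
    u != v -> deg E v = 0 -> (exists f, good_coloring h E f) ->
  exists f, good_coloring h ([set u; v] |: E) f.
Proof.
move=> nuv dv [f gf].
have nE : [set u; v] \notin E.
  apply/negP => uv; move/eqP: dv; rewrite cards_eq0 => /eqP/setP/(_ u).
  by rewrite !inE /erel setUC uv.
have dcv c : deg (color_class f E c) v = 0.
  apply/eqP; rewrite -leqn0 -dv; apply: degS; apply/subsetP => s.
  by rewrite inE => /andP[].
have [c uc] : exists c,
    deg (color_class f E c) u < capacity h (deg ([set u; v] |: E) u) c.
  have := deg_classes f E u; rewrite deg_setU1 //.
  case: (ltnP (deg (color_class f E (Some true)) u)
    (capacity h (deg E u).+1 (Some true))) => [|H1]; first by exists (Some true).
  case: (ltnP (deg (color_class f E (Some false)) u)
    (capacity h (deg E u).+1 (Some false))) => [|H2]; first by exists (Some false).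
  by move=> H3; exists None; move: H1 H2 H3 => /=; lia.
apply: (good_coloring_setU1 (c := c) nuv nE gf) => [b _|x].
  by rewrite connect_erel_sym; apply/negP=> /connect_deg; rewrite dcv eq_sym => /(_ nuv).
rewrite !inE => /orP[]/eqP-> //; rewrite dcv.
(* For the color [None], the room at [u] shows [0 < h], hence room at [v]. *)
by case: c uc => [b|] /= H; lia.
Qed.

(** A forest that cannot take the edge uses at least 2 of the total degree of [u] and [v]: one end
    has degree 2 in it, or it connects them and both have degree at least 1. If both forests fail,
    at most [h - 1] remains for [H] at [u] and [v] together. *)
Lemma good_coloring_light h E u v :
    u != v -> [set u; v] \notin E -> deg E u + deg E v <= h + 3 ->
    (exists f, good_coloring h E f) ->
  exists f, good_coloring h ([set u; v] |: E) f.
Proof.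
move=> nuv nE duv [f gf].
pose d c x := deg (color_class f E c) x.
have dE x : d (Some true) x + d (Some false) x + d None x = deg E x.
  exact: deg_classes.
have d_gt0 b x y : x != y -> connect (erel (color_class f E (Some b))) x y ->
  0 < d (Some b) x by apply: connect_deg.
case: (boolP [exists b, ~~ connect (erel (color_class f E (Some b))) u v &&
   (d (Some b) u < 2) && (d (Some b) v < 2)]).
  case/existsP => b /andP[/andP[nc du2] dv2].
  apply: (good_coloring_setU1 (c := Some b) nuv nE gf) => [//|x].
  by rewrite !inE => /orP[]/eqP-> /=; rewrite leq_max ?du2 ?dv2.
rewrite negb_exists => /forallP Hb.
have Hd b : 2 <= d (Some b) u + d (Some b) v.
  have := Hb b; rewrite !negb_and negbK -!leqNgt -orbA => /or3P[cuv|du2|dv2]; first last.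
  - exact: leq_trans dv2 (leq_addl _ _).
  - exact: leq_trans du2 (leq_addr _ _).
  have cu := d_gt0 _ _ _ nuv cuv.
  rewrite eq_sym in nuv; rewrite connect_erel_sym in cuv.
  exact: leq_add cu (d_gt0 _ _ _ nuv cuv).
have := (Hd true, Hd false, dE u, dE v) => -[[[Ht Hf] du] dv].
apply: (good_coloring_setU1 (c := None) nuv nE gf) => // x.
by rewrite !inE => /orP[]/eqP-> /=; rewrite -/(d None _); lia.
Qed.

End Colorings.

(** * Recoloring a 2-alternating cycle *)

(* The alternating cycle visits e i, w i in turn, and w (psi i) precedes e i. *)
Section Alternating.
Variables (T I : finType) (h : nat) (E : {set {set T}}).
Variables (e w : I -> T) (psi : I -> I).
Hypotheses (E_pairs : forall s, s \in E -> exists x y, s = [set x; y])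
  (e_inj : injective e) (w_inj : injective w) (psi_inj : injective psi)
  (psi_neq : forall i, psi i != i) (e_neq_w : forall i j, e i != w j)
  (nbr_e : forall i, nbr E (e i) = [set w i; w (psi i)]).

(** Exactly the cycle edges are deleted, as each [e i] has only its two cycle neighbors. *)
Let E' : {set {set T}} := [set s in E | [forall i, e i \notin s]].

Lemma erel_e i y : erel E (e i) y -> y = w i \/ y = w (psi i).
Proof.
have := nbr_e i => /setP/(_ y); rewrite !inE => -> /orP[]/eqP; auto.
Qed.

Lemma erel_ew i : erel E (e i) (w i).
Proof. by have /setP/(_ (w i)) := nbr_e i; rewrite !inE eqxx. Qed.

Lemma erel_ewpsi i : erel E (e i) (w (psi i)).
Proof. by have /setP/(_ (w (psi i))) := nbr_e i; rewrite !inE eqxx orbT. Qed.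

Lemma sub_remainder : E' \subset E.
Proof. by apply/subsetP => s; rewrite inE => /andP[]. Qed.

Lemma remainder_e s i : s \in E' -> e i \notin s.
Proof. by rewrite inE => /andP[_ /forallP]. Qed.

Lemma not_remainder s : s \in E -> s \notin E' -> exists2 i, e i \in s &
  s = [set e i; w i] \/ s = [set e i; w (psi i)].
Proof.
move=> sE; rewrite inE sE negb_forall => /existsP[i]; rewrite negbK => eis.
exists i => //; have [x [y sxy]] := E_pairs sE.
have [z sz] : exists z, s = [set e i; z].
  move: eis; rewrite sxy !inE => /orP[]/eqP->; [by exists y|].
  by exists x; rewrite setUC.
have : erel E (e i) z by rewrite /erel -sz.
by case/erel_e => ez; rewrite sz ez; auto.
Qed.

(** The lost edges lead to [e i] and to [e j] with [psi j = i]; they differ because [psi] has no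
    fixed point. *)
Lemma deg_remainder_w i : deg E' (w i) + 2 <= deg E (w i).
Proof.
pose j := invF psi_inj i; have ej : psi j = i by apply: f_invF.
have nij : e i != e j by rewrite (inj_eq e_inj) -ej psi_neq.
rewrite /deg -(_ : #|[set e i; e j]| = 2); last by rewrite cards2 nij.
rewrite -cardsUI (_ : _ :&: _ = set0) ?cards0 ?addn0.
  apply/subset_leq_card/subsetP => y; rewrite !inE => /or3P[||].
  - exact: (subsetP sub_remainder).
  - by move=> /eqP->; rewrite erel_sym erel_ew.
  - by move=> /eqP->; rewrite erel_sym -{1}ej erel_ewpsi.
apply/setP => y; rewrite !inE; apply/negP => /andP[yE /orP[]/eqP ey].
  by have := remainder_e i yE; rewrite ey set22.
by have := remainder_e j yE; rewrite ey set22.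
Qed.

(* At an odd vertex [w i] the edges to [e i] and to the next even vertex get
   the colors [L i] and [R i]. Where both forests have room the colors are the
   two forests, oriented as [sigma i], which is inherited from the previous odd
   vertex; otherwise [L i] is [None] and [sigma i] is set afresh. The recursion
   for [sigma] is circular, but monotone, so it has a fixed point. *)
Lemma alternating_colors f : good_coloring h E' f ->
  exists L R : I -> option bool,
    [/\ forall c i, deg (color_class f E' c) (w i) + (L i == c) + (R i == c)
          <= capacity h (deg E (w i)) c,
        forall i, L i = None -> 0 < h,
        forall i, R i = None -> 1 < h &
        forall i b, L i = Some b -> R (psi i) <> Some b].
Proof.
case=> _ gf; pose d c i := deg (color_class f E' c) (w i).
pose k i := maxn 2 (uphalf ((deg E (w i)).+1 - h)).
pose A i := (d (Some true) i < k i) && (d (Some false) i < k i).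
pose F (S : {set I}) : {set I} :=
  [set j | if A j then psi j \in S else d (Some true) j < k j].
have F_mono : {homo F : X Y / X \subset Y}.
  move=> X Y /subsetP XY; apply/subsetP => j; rewrite !inE.
  by case: (A j) => //; apply: XY.
pose sigma j := j \in fixset F.
have sigmaE j : sigma j = if A j then sigma (psi j) else d (Some true) j < k j.
  by rewrite {1}/sigma -(fixsetK F_mono) inE.
pose L i := if A i then Some (~~ sigma i) else None.
(* Where [A i] fails, [sigma i] selects a forest with room if there is one; so [R i] is [None] only
   when both forests are full. *)
pose R i := if d (Some (sigma i)) i < k i then Some (sigma i) else None.
(* If a forest is full at [w i] then [k i = 2], since a larger bound would have dropped with the two
   lost edges. So at most [h + 1] remaining edges meet [w i], and each full forest takes two of
   them. *)
have room i : [/\ d (Some true) i <= k i, d (Some false) i <= k i, d None i <= h,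
    ~~ A i -> d None i < h &
    k i <= d (Some true) i -> k i <= d (Some false) i -> d None i + 2 < h].
  have dE : d (Some true) i + d (Some false) i + d None i = deg E' (w i).
    exact: deg_classes.
  have := deg_remainder_w i.
  have := gf (Some true) (w i); have := gf (Some false) (w i).
  have := gf None (w i); rewrite /= -/(d (Some true) i) -/(d (Some false) i) -/(d None i) /A /k.
  move: dE; move: (d _ i) (d _ i) (d _ i) (deg E' _) (deg E _) => a b c x y.
  by move=> *; split; lia.
exists L, R; split.
- move=> c i; have [r1 r2 r3 r4 r5] := room i; rewrite -/(d c i).
  rewrite /L /R; have := sigmaE i.
  case EA: (A i).
    move=> _; move: EA => /andP[A1 A2].
    by case: (sigma i); rewrite ?A1 ?A2; case: c => [[]|] //=; rewrite -/(k i); lia.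
  move: EA => /negbT /[dup] /r4 r4' ; rewrite negb_and -!leqNgt => EA.
  have [lt1|ge1] := ltnP (d (Some true) i) (k i) => ->.
    rewrite lt1; case: c => [[]|] //=; rewrite -/(k i); lia.
  have [lt2|ge2] := ltnP (d (Some false) i) (k i).
    by case: c => [[]|] //=; rewrite -/(k i); lia.
  by have := r5 ge1 ge2; case: c => [[]|] //=; rewrite -/(k i); lia.
- move=> i; have [_ _ _ r4 _] := room i; rewrite /L; case: (A i) r4 => // /(_ isT) r _; lia.
- move=> i; have [_ _ _ _ r5] := room i; rewrite /R; have := sigmaE i; rewrite /A.
  have [d1|d1] := ltnP (d (Some true) i) (k i); last first.
    by move=> /= ->; case: ltnP => // d2 _; have := r5 d1 d2; lia.
  have [d2|d2] := ltnP (d (Some false) i) (k i) => /= ->; last by rewrite d1.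
  by case: (sigma _); rewrite ?d1 ?d2.
(* A forest color for [L i] forces [A i], so [sigma] agrees at [i] and [psi i], while [L] uses its
   negation. *)
move=> i b; rewrite /L /R; have := sigmaE i; case: (A i) => // -> [<-].
by case: ifP => // _ []; case: (sigma _).
Qed.

Lemma good_coloring_alternating :
  (exists f, good_coloring h E' f) -> exists f, good_coloring h E f.
Proof.
case=> f gf; have [L [R [LR_le Lh Rh LR_neq]]] := alternating_colors gf.
case: gf => af df.
(* A cycle edge has a unique even end [e i]; its color is the one chosen at its odd end, [w i] or
   [w (psi i)]. *)
pose f' (s : {set T}) := if [pick i | e i \in s] is Some i then
  if s == [set e i; w i] then L i else R (psi i) else f s.
have f'_e i j : f' [set e i; w j] = if j == i then L i else R (psi i).
  rewrite /f'; case: pickP => [i'|/(_ i)]; last by rewrite set21.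
  rewrite !inE (negbTE (e_neq_w _ _)) orbF (inj_eq e_inj) => /eqP->.
  suff -> : ([set e i; w j] == [set e i; w i]) = (j == i) by [].
  apply/eqP/eqP => [/set2_eq[] [] ei ew|->//]; first exact: w_inj.
  by have := e_neq_w i i; rewrite ei eqxx.
have f'_rem s : s \in E' -> f' s = f s.
  move=> sE'; rewrite /f'; case: pickP => // i.
  by rewrite (negbTE (remainder_e i sE')).
have f'L i : f' [set e i; w i] = L i by rewrite f'_e eqxx.
have f'R i : f' [set e i; w (psi i)] = R (psi i).
  by rewrite f'_e (negbTE (psi_neq i)).
have deg0 c i : deg (color_class f E' c) (e i) = 0.
  apply/eqP; rewrite cards_eq0; apply/eqP/setP => y; rewrite !inE erel_class.
  by apply/negP => /andP[/(remainder_e i)]; rewrite set21.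
exists f'; split=> [b|c x].
  pose g i := if L i == Some b then w i else w (psi i).
  have eg i j : e i != g j by rewrite /g; case: ifP.
  apply: acyclicS (acyclic_pendants e_inj eg (deg0 (Some b)) (af b)).
  apply/subsetP => s; rewrite inE => /andP[sE fs]; rewrite inE.
  have [sE'|sE'] := boolP (s \in E').
    by rewrite inE sE' -f'_rem // fs.
  apply/orP; right; have [i _ es] := not_remainder sE sE'.
  apply/imsetP; exists i => //; rewrite /g.
  case: es fs => ->; first by rewrite f'L => ->.
  by rewrite f'R => /eqP Rb; case: eqP => // /LR_neq.
case: (pickP (fun i => x == e i)) => [i /eqP->|not_e].
  have le : deg (color_class f' E c) (e i) <= (L i == c) + (R (psi i) == c).
    rewrite -[X in _ <= X + _]add0n -(cards0 T).
    apply: (@card_setU_two _ _ _ (w i) (w (psi i))) => z.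
    rewrite inE erel_class => /andP[/erel_e[]->].
      by rewrite f'L; constructor 2.
    by rewrite f'R; constructor 3.
  apply: leq_trans le _; case: c => [b|] /=.
    by apply: leq_trans (leq_maxl _ _); do 2!case: eqP.
  (* Both edges at [e i] can lie in [H] only if [R (psi i)] is [None], and then [1 < h]. *)
  case: eqP => [/Lh h1|_]; case: eqP => [/Rh h2|_]; lia.
case: (pickP (fun i => x == w i)) => [i /eqP->|not_w].
  pose j := invF psi_inj i; have ej : psi j = i by apply: f_invF.
  apply: leq_trans (LR_le c i).
  apply: (@card_setU_two _ _ _ (e i) (e j)) => z.
  rewrite !inE !erel_class => /andP[wz fz].
  have [wzE'|wzE'] := boolP ([set w i; z] \in E').
    by constructor 1; rewrite [erel _ _ _]wzE' -f'_rem.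
  have [m _ []] := not_remainder wz wzE' => em; move: (em) fz => -> .
    rewrite f'L; case: (set2_eq em) => [] [e1 e2]; first by have := e_neq_w m i; rewrite e1 eqxx.
    by constructor 2; rewrite e2 (w_inj e1).
  rewrite f'R; case: (set2_eq em) => [] [e1 e2]; first by have := e_neq_w m i; rewrite e1 eqxx.
  have /w_inj e3 := e1; constructor 3; rewrite e2 e3; split=> //.
  by congr e; apply: psi_inj; rewrite ej e3.
apply: leq_trans (leq_trans (df c x) _); last exact/capacityS/degS/sub_remainder.
apply/subset_leq_card/subsetP => z; rewrite !inE !erel_class => /andP[xz fz].
have [xzE'|xzE'] := boolP ([set x; z] \in E'); first by rewrite [erel _ _ _]xzE' -f'_rem.
have [m _ []] := not_remainder xz xzE' => /set2_eq[] [e1 _].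
- by have := not_e m; rewrite e1 eqxx.
- by have := not_w m; rewrite e1 eqxx.
- by have := not_e m; rewrite e1 eqxx.
- by have := not_w (psi m); rewrite e1 eqxx.
Qed.

End Alternating.

(** * Translation between subgraphs and edge sets *)

Section Subgraphs.
Variables (G : sgraph) (S : subgraph G).

Lemma degree_subgraph (x : S) : degree x = deg (sub_edges S) (val x).
Proof.
rewrite /degree /deg -(card_imset _ val_inj); apply: eq_card => y.
rewrite inE; apply/imsetP/idP => [[z + ->]|xy]; first by rewrite inE.
have yS : y \in sub_vertices S.
  by apply: (subsetP (sub_edges_vertices xy)); rewrite set22.
by exists (Sub y yS); rewrite ?inE.
Qed.

Lemma ucycle_subgraph (c : seq S) :
  ucycle (@adj S) c -> ucycle (erel (sub_edges S)) (map val c).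
Proof.
case/andP => cc uc; apply/andP; rewrite map_inj_uniq ?(cycle_map (f := val)) //.
exact: val_inj.
Qed.

Lemma acyclic_forest : acyclic (sub_edges S) -> is_forest S.
Proof.
move=> aS c [sc /ucycle_subgraph]; apply: acyclic_ucycle => //.
by rewrite size_map.
Qed.

End Subgraphs.

(** The vertex [x] matters for the default value of the minimum: if all degrees exceed [k], so does
    [max_degree G]. *)
Lemma min_degree_exists (G : sgraph) (x : G) k :
  min_degree G <= k -> exists y : G, degree y <= k.
Proof.
have [/existsP[y dy] _|] := boolP [exists y : G, degree y <= k]; first by exists y.
rewrite negb_exists => /forallP H; rewrite leqNgt => /negP[].
have gtk (y : G) : k < degree y by rewrite ltnNge; apply: H.
rewrite /min_degree; elim/big_ind: _ => // [|a b ka kb].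
  by apply: leq_trans (gtk x) _; apply: leq_bigmax.
by rewrite leq_min ka.
Qed.

Lemma edge_set2 (G : sgraph) (s : {set G}) :
  s \in edges G -> exists x y, s = [set x; y].
Proof. by case/imsetP => -[x y] _ ->; exists x, y. Qed.

Lemma cycle_nth (T : Type) (r : rel T) x0 (c : seq T) i :
  cycle r c -> i < size c -> r (nth x0 c i) (nth x0 c (i.+1 %% size c)).
Proof.
case: c => // x p /(pathP x0) H ip; have := H i; rewrite size_rcons => /(_ ip).
rewrite -rcons_cons nth_rcons ip nth_rcons /=.
move: ip => /=; rewrite ltnS leq_eqVlt => /orP[/eqP->|ip].
  by rewrite modnn ltnn eqxx.
by rewrite modn_small ?ltnS // ip.
Qed.

(** * Induction on the number of edges *)

Lemma good_coloring_exists (alpha : nat) (C : sgraph -> Prop) (G : sgraph) :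
    5 <= alpha -> hereditary C ->
    (forall G : sgraph, C G ->
       [\/ min_degree G <= 1,
           exists u v : G, adj u v /\ degree u + degree v <= alpha |
           exists c : seq G, is_2alternating_cycle c]) ->
    C G ->
  forall E : {set {set G}}, E \subset edges G -> exists f, good_coloring (alpha - 5) E f.
Proof.
move=> halpha hereditaryC structC CG E; have [m] := ubnP #|E|.
elim: m E => // m IHm E ltE EG.
have loopless x y : erel E x y -> x != y.
  by move/(subsetP EG); rewrite set2_edges; apply: contraTneq => ->; rewrite adj_irrefl.
have IH s : s \in E -> exists f, good_coloring (alpha - 5) (E :\ s) f.
  move=> sE; apply: IHm; last exact: subset_trans (subsetDl _ _) EG.
  by move: ltE; rewrite (cardsD1 s) sE; lia.
have degD1 u v : erel E u v -> deg E u = (deg (E :\ [set u; v]) u).+1.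
  by move=> uv; rewrite -(@deg_setU1 _ _ u v) ?setD1K // !inE eqxx.
case: (set_0Vmem E) => [->|[s0 s0E]].
  exists (fun=> None); split => [b x y|c x]; first by rewrite /erel !inE.
  rewrite (_ : deg _ _ = 0) //; apply/eqP; rewrite cards_eq0.
  by apply/eqP/setP => y; rewrite !inE /erel !inE.
have sub_cover s : s \in E -> s \subset cover E by apply: bigcup_sup.
(* Keeping only the vertices covered by [E] excludes isolated ones, so minimum degree at most 1
   yields a leaf. *)
pose S := Subgraph EG sub_cover.
have CS : C S by apply: hereditaryC.
case: (structC S CS) => [|[u [v [uv duv]]]|[c [[sc /ucycle_subgraph uc]]]].
- have [x0 [y0 es0]] := edge_set2 (subsetP EG _ s0E).
  have x0S : x0 \in sub_vertices S.
    by apply: (subsetP (sub_cover _ s0E)); rewrite es0 set21.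
  case/(min_degree_exists (Sub x0 x0S : S)) => x; rewrite degree_subgraph => dx.
  have [s sE xs] : exists2 s, s \in E & val x \in s.
    by have /bigcupP := valP x.
  have [y xy] : exists y, s = [set val x; y].
    have [a [b es]] := edge_set2 (subsetP EG _ sE); move: xs; rewrite es !inE.
    by case/orP => /eqP->; [exists b|exists a; rewrite setUC].
  rewrite xy in sE; rewrite -(setD1K sE) [X in X |: _]setUC.
  have nxy := loopless _ _ sE.
  apply: good_coloring_pendant; [by rewrite eq_sym| |exact: IH].
  by move: dx; rewrite (degD1 _ _ sE); case: (deg _ _).
- have uvE : erel E (val u) (val v) by [].
  rewrite -(setD1K uvE); apply: good_coloring_light;
    [exact: loopless|by rewrite !inE eqxx| |exact: IH].
  (* Deleting the edge lowers both degrees by 1, and [alpha - 2] is [h + 3] for [h = alpha - 5]. *)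
  move: duv; rewrite !degree_subgraph (degD1 _ _ uvE).
  have vuE := uvE; rewrite erel_sym in vuE.
  rewrite (degD1 _ _ vuE) [X in E :\ X]setUC; move: (deg _ _) (deg _ _) => a b; lia.
case=> n n2 [cn deg2].
case: c sc uc cn deg2 => // x0 c' _; move: (x0 :: c') => c uc cn deg2.
pose p := map val c; pose z0 : G := val x0.
have szp : size p = n.*2 by rewrite size_map.
case/andP: uc => cyc_p uniq_p.
pose e (i : 'I_n) := nth z0 p i.*2; pose w (i : 'I_n) := nth z0 p i.*2.+1.
have lte (i : 'I_n) : i.*2 < size p by rewrite szp ltn_double.
have ltw (i : 'I_n) : i.*2.+1 < size p by rewrite szp ltn_Sdouble.
(* [ord_pred] is cyclic: at [i = 0] the preceding odd vertex is the last one of the cycle. *)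
have next_pred (i : 'I_n) : (ord_pred i).*2.+2 %% n.*2 = i.*2.
  by rewrite -doubleS -!mul2n -muln_modr -[in RHS](ord_predK i).
have pred_neq (i : 'I_n) : ord_pred i != i.
  apply/eqP => ei; have := next_pred i; rewrite ei.
  have := lte i; rewrite szp ltn_double -doubleS leq_eqVlt => /orP[/eqP ein|lti].
    by rewrite ein modnn; lia.
  by rewrite modn_small ?ltn_double //; lia.
have e_inj : injective e.
  by move=> i j /eqP; rewrite nth_uniq // => /eqP/double_inj/val_inj.
have w_inj : injective w.
  by move=> i j /eqP; rewrite nth_uniq // => /eqP[/double_inj/val_inj].
have e_neq_w i j : e i != w j by rewrite nth_uniq //; lia.
have ew i : erel E (e i) (w i).
  by have := cycle_nth z0 cyc_p (lte i); rewrite modn_small.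
have ewpred i : erel E (e i) (w (ord_pred i)).
  by have := cycle_nth z0 cyc_p (ltw (ord_pred i)); rewrite szp next_pred erel_sym.
have nbr_e i : nbr E (e i) = [set w i; w (ord_pred i)].
  apply/esym/eqP; rewrite eqEcard; apply/andP; split.
    by apply/subsetP => y; rewrite !inE => /orP[]/eqP->.
  rewrite cards2 (inj_eq w_inj) eq_sym pred_neq.
  have := deg2 x0 i (ltn_ord i); rewrite degree_subgraph /e.
  rewrite (nth_map x0) /deg; last by rewrite cn -szp.
  by move=> ->.
apply: (good_coloring_alternating _ e_inj w_inj (@ord_pred_inj n) pred_neq e_neq_w nbr_e).
  by move=> s /(subsetP EG); apply: edge_set2.
apply: IHm; last by apply: (subset_trans _ EG); apply/subsetP => s; rewrite inE => /andP[].
have n0 : 0 < n by lia.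
rewrite -ltnS; apply: leq_ltn_trans ltE; apply: proper_card; apply/properP; split.
  by apply/subsetP => s; rewrite inE => /andP[].
exists [set e (Ordinal n0); w (Ordinal n0)]; first exact: ew.
rewrite inE negb_and; apply/orP; right; rewrite negb_forall; apply/existsP.
by exists (Ordinal n0); rewrite negbK set21.
Qed.

(* [uphalf n] is the ceiling of n / 2. Truncated subtraction is harmless: where
   max_degree G + 6 < alpha the ceiling is at most 0 and the maximum is 2. *)
Theorem theorem3 (alpha : nat) (halpha : 5 <= alpha)
    (C : sgraph -> Prop) (hereditaryC : hereditary C)
    (structC : forall G : sgraph, C G ->
       [\/ min_degree G <= 1,
           exists u v : G, adj u v /\ degree u + degree v <= alpha |
           exists c : seq G, is_2alternating_cycle c])
    (G : sgraph) (CG : C G) :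
  exists F1 F2 H : subgraph G,
    [/\ edge_partition F1 F2 H,
        is_forest F1 /\ is_forest F2,
        max_degree F1 <= maxn 2 (uphalf (max_degree G + 6 - alpha)),
        max_degree F2 <= maxn 2 (uphalf (max_degree G + 6 - alpha)) &
        max_degree H <= alpha - 5].
Proof.
have [f [af df]] := good_coloring_exists halpha hereditaryC structC CG (subxx _).
have sub_class c : color_class f (edges G) c \subset edges G.
  by apply/subsetP => s; rewrite inE => /andP[].
have inT c (s : {set G}) : s \in color_class f (edges G) c -> s \subset setT.
  by move=> _; apply: subsetT.
pose K c := Subgraph (sub_class c) (inT c).
have deg_le (x : G) : deg (edges G) x <= max_degree G.
  apply: leq_trans (leq_bigmax x); apply/subset_leq_card/subsetP => y.
  by rewrite !inE /erel set2_edges.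
have forest_le b :
    max_degree (K (Some b)) <= maxn 2 (uphalf (max_degree G + 6 - alpha)).
  apply/bigmax_leqP => x _; rewrite degree_subgraph.
  apply: leq_trans (df _ _) _; have := deg_le (val x); move: (deg _ _) => a /=; lia.
have disj c c' : c != c' -> [disjoint sub_edges (K c) & sub_edges (K c')].
  move=> cc'; rewrite -setI_eq0; apply/eqP/setP => s; rewrite !inE.
  by apply/negP => /andP[/andP[_ /eqP->]]; rewrite (negbTE cc') andbF.
exists (K (Some true)), (K (Some false)), (K None); split => //.
- split; [|exact: disj|exact: disj|exact: disj].
  by apply/setP => s; rewrite !inE; case: (s \in _) (f s) => [] [[]|].
- by split; apply: acyclic_forest; apply: af.
- by apply/bigmax_leqP => x _; rewrite degree_subgraph; apply: df.
Qed.
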